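(* Fix an integer $a\ge 1$ and a field $F$. Let $d,n,t$ be positive integers. Then the following statements hold (whenever the quantities involved are defined): (1) $d_{n+1,t}>d_{n,t}$. (2) $d_{n,t+1}\le d_{n,t}$. Moreover, for $n\ge 3$ we have $d_{n,t'}=d^{<n-2>}$ for all sufficiently large $t'$.
   Context: For $n\ge 1$ let $R=F[x_1,\dots,x_n]/(x_1^a)$, with all variables of degree $1$ and $R_t$ the homogeneous component of degree $t$. The monomials in $R_t$ are the monomials of degree $t$ in $F[x_1,\dots,x_n]$ not divisible by $x_1^a$, ordered lexicographically with $x_1>\dots>x_n$. A set $L$ of monomials in $R_t$ is lexsegment if whenever $m\in L$ and $v$ is a monomial in $R_t$ with $v>m$, then $v\in L$. For a set $M$ of monomials in $R_t$, $R_1\cdot M$ is the set of monomials $x_im$ ($1\le i\le n$, $m\in M$) that are nonzero in $R$, i.e. not divisible by $x_1^a$. $d_{n,t}$ denotes $|R_1\cdot L|$, where $L$ is the lexsegment set of $d$ monomials in $R_t$. It is defined only when $d$ is at most the number of monomials in $R_t$, and this is always assumed when $d_{n,t}$ is written. For $k\ge 1$ and $d\ge 0$, $d^{<k>}$ is the number of monomials of the form $um$ with $u$ a variable and $m\in L$, where $L$ is a lexsegment set (closed upward in lexicographic order among monomials of its degree) of $d$ monomials of some fixed degree in a polynomial ring in $k+1$ variables; by Macaulay this depends only on $d$ and $k$, not on the degree, as long as the degree is large enough for $L$ to exist. *)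

(* Defs.v *)
From HB Require Import structures.
From mathcomp Require Export all_boot all_order all_algebra.
From mathcomp Require Export boolp classical_sets cardinality.
From mathcomp Require Export finmap mpoly.

Set Implicit Arguments.
Unset Strict Implicit.
Unset Printing Implicit Defensive.

Import Order.TTheory GRing.Theory.

Local Open Scope classical_set_scope.
Local Open Scope ring_scope.

(* The value is 0 on infinite sets; the definitions below only use it on sets of
   monomials of a fixed degree, which are finite (finite_component). *)
Definition ncard (T : choiceType) (A : set T) : nat := #|` fset_set A|%N.

(* The ideal (x_1^a) of F[x_1,...,x_n]; x_1 is the variable of index 0, and
   n >= 1 in all uses. *)
Definition x1_ideal (F : fieldType) (a n : nat) : set {mpoly F[n]} :=
  [set p | exists2 i : 'I_n, val i = 0%N &
           exists q : {mpoly F[n]}, p = q * 'X_i ^+ a].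

(* Monomials with nonzero image in F[x_1,...,x_n]/(x_1^a). *)
Definition nonzero_mon (F : fieldType) (a n : nat) : set 'X_{1.. n} :=
  [set m | ~ x1_ideal a ('X_[m] : {mpoly F[n]})].
Arguments nonzero_mon : clear implicits.

(* In what follows B is the set of nonzero monomials of the ring:
   nonzero_mon F a n for F[x_1,...,x_n]/(x_1^a), setT for a polynomial ring. *)
Definition component (n : nat) (B : set 'X_{1.. n}) (t : nat) :
    set 'X_{1.. n} :=
  [set m | B m /\ mdeg m = t].

(* The order of multinomials on 'X_{1.. n} compares degrees, then exponents
   lexicographically starting from index 0: within one degree it is the
   lexicographic order with x_1 > ... > x_n (ltmcP). *)
Definition lexsegment (n : nat) (B : set 'X_{1.. n}) (t : nat)
    (L : set 'X_{1.. n}) : Prop :=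
  L `<=` component B t /\
  forall m v : 'X_{1.. n}, L m -> component B t v -> (m < v)%O -> L v.

(* R_1 . M *)
Definition mul_vars (n : nat) (B M : set 'X_{1.. n}) : set 'X_{1.. n} :=
  [set w | B w /\ exists (i : 'I_n) (m : 'X_{1.. n}), M m /\ w = (U_(i) + m)%MM].

(* The values |R_1 . L|, for L a lexsegment set of d monomials of degree t:
   a set with at most one element (lex_growth_uniq). *)
Definition lex_growth (n : nat) (B : set 'X_{1.. n}) (t d : nat) : set nat :=
  [set N | exists L : set 'X_{1.. n},
     [/\ lexsegment B t L, ncard L = d & N = ncard (mul_vars B L)]].

(* d_{n,t}, meaningful only when d <= ncard (component (nonzero_mon F a n) t)
   (lexsegment_exists). *)
Definition d_nt (F : fieldType) (a d n t : nat) : nat :=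
  xget 0%N (lex_growth (nonzero_mon F a n) t d).

(* d^{<k>}, meaningful for 1 <= k. The degree s is left to the choice operator,
   as the value does not depend on it (lex_growth_deg). *)
Definition macaulay (d k : nat) : nat :=
  xget 0%N [set N | exists s : nat,
                    lex_growth (setT : set 'X_{1.. k.+1}) s d N].

Lemma nonzero_monP (F : fieldType) (a n : nat) (m : 'X_{1.. n}) :
  nonzero_mon F a n m <-> forall i : 'I_n, val i = 0%N -> (m i < a)%N.
Proof.
split=> [nz i i0|lt_ma [i i0 [q Em]]].
  rewrite ltnNge; apply/negP=> le_am; apply: nz; exists i => //.
  exists 'X_[m - U_(i) *+ a].
  rewrite mpolyXn -mpolyXD submK //; apply/mnm_lepP => j.
  by rewrite mulmnE mnm1E; case: eqP => [<-|_]; rewrite ?mul1n ?mul0n.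
have : m \in msupp ('X_[m] : {mpoly F[n]}) by rewrite msuppX inE.
rewrite Em mpolyXn (perm_mem (msuppMX _ _)) => /mapP[m' _ Dm].
by move: (lt_ma i i0); rewrite Dm mnmDE mulmnE mnm1E eqxx mul1n ltnNge leq_addr.
Qed.

Lemma finite_component (n : nat) (B : set 'X_{1.. n}) (t : nat) :
  finite_set (component B t).
Proof.
apply: (@sub_finite_set _ _ [set bmnm m | m in [set: 'X_{1..n < t.+1}]]).
  move=> m [_ dm]; have lt_m : (mdeg m < t.+1)%N by rewrite dm.
  by exists (BMultinom lt_m).
exact/finite_image/finite_finset.
Qed.

Lemma lexsegment_finite (n : nat) (B : set 'X_{1.. n}) (t : nat) L :
  lexsegment B t L -> finite_set L.
Proof. by case=> sLB _; apply: sub_finite_set sLB (finite_component B t). Qed.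

Lemma ncard_subE (T : choiceType) (A A' : set T) :
  finite_set A' -> A `<=` A' -> ncard A = ncard A' -> A = A'.
Proof.
move=> fA' sAA' eqc; have fA := sub_finite_set sAA' fA'.
suff E : fset_set A = fset_set A' by rewrite -(fset_setK fA) E fset_setK.
apply/eqP; rewrite eqEfcard -/(ncard A) -/(ncard A') eqc leqnn andbT.
by apply/fsubsetP => x; rewrite !in_fset_set // !in_setE; apply: sAA'.
Qed.

Lemma lexsegment_uniq (n : nat) (B : set 'X_{1.. n}) (t : nat) L L' :
  lexsegment B t L -> lexsegment B t L' -> ncard L = ncard L' -> L = L'.
Proof.
move=> lL lL' eqc; have [fL fL'] := (lexsegment_finite lL, lexsegment_finite lL').
case: lL lL' => sL upL [sL' upL'].
have [sLL'|/existsNP[m /not_implyP[Lm nL'm]]] := pselect (L `<=` L').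
  exact: ncard_subE.
apply/esym/ncard_subE => // v L'v; have [lt_mv|le_vm] := ltP m v.
  by apply: upL Lm _ lt_mv; apply: sL'.
move: le_vm; rewrite le_eqVlt => /predU1P[->//|lt_vm].
by case: nL'm; apply: upL' L'v _ lt_vm; apply: sL.
Qed.

Lemma lexsegment_exists (n : nat) (B : set 'X_{1.. n}) (t d : nat) :
  (d <= ncard (component B t))%N -> exists2 L, lexsegment B t L & ncard L = d.
Proof.
elim: d => [_|d IHd lt_d].
  by exists set0; [split | rewrite /ncard fset_set0 cardfs0].
have [L lL cL] := IHd (ltnW lt_d); have fL := lexsegment_finite lL.
have fC := finite_component B t.
have [m0 [Cm0 nLm0]] : exists m, component B t m /\ ~ L m.
  apply: contrapT => noM; move: lt_d; rewrite ltnNge -cL /ncard.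
  rewrite fsubset_leq_card //; apply/fsubsetP => x.
  rewrite !in_fset_set // !in_setE => Cx.
  by apply: contrapT => nLx; apply: noM; exists x.
pose D := component B t `\` L.
have fD : finite_set D by apply: sub_finite_set fC; apply: subDsetl.
have D0 : m0 \in fset_set D by rewrite in_fset_set // in_setE.
pose i0 : fset_set D := FSetSub D0.
have [i _ maxi] := @arg_maxP _ _ _ i0 xpredT (fun i : fset_set D => val i) isT.
have [Ci nLi] : D (val i) by have := valP i; rewrite in_fset_set // in_setE.
exists (val i |` L).
  case: lL => sL upL; split=> [x [->//|/sL//]|m v + Cv lt_mv].
  case=> [Em|Lm]; last by right; apply: upL Lm Cv lt_mv.
  right; apply: contrapT => nLv.
  have Dv : v \in fset_set D by rewrite in_fset_set // in_setE.
  by have := maxi (FSetSub Dv) isT; rewrite /= leNgt -Em lt_mv.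
rewrite /ncard fset_setU1 // cardfsU1 in_fset_set // -cL.
by have /negbTE -> : val i \notin L by apply/negP; rewrite in_setE.
Qed.

Lemma lex_growth_uniq (n : nat) (B : set 'X_{1.. n}) (t d N N' : nat) :
  lex_growth B t d N -> lex_growth B t d N' -> N = N'.
Proof.
move=> [L [lL cL ->]] [L' [lL' cL' ->]].
by rewrite (lexsegment_uniq lL lL') // cL.
Qed.

Lemma ncard_image (T T' : choiceType) (f : T -> T') (A : set T) :
  injective f -> finite_set A -> ncard (f @` A) = ncard A.
Proof.
by move=> f_inj fA; rewrite /ncard fset_set_image // card_imfset.
Qed.

Lemma lex_growth_deg (k s s' d N N' : nat) :
  lex_growth (setT : set 'X_{1.. k.+1}) s d N ->
  lex_growth (setT : set 'X_{1.. k.+1}) s' d N' -> N = N'.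
Proof.
have up1 u M : lex_growth (setT : set 'X_{1.. k.+1}) u d M ->
    lex_growth (setT : set 'X_{1.. k.+1}) u.+1 d M.
  move=> [L [lL cL ->]]; have fL := lexsegment_finite lL.
  case: (lL) => sL upL.
  pose f (m : 'X_{1.. k.+1}) := (U_(ord0) + m)%MM.
  have f_inj : injective f by move=> x y /eqP; rewrite eqm_add2l => /eqP.
  have fCA i m : f (U_(i) + m)%MM = (U_(i) + f m)%MM.
    by rewrite /f !addmA [(U_(ord0) + _)%MM]addmC.
  exists (f @` L); split; last 1 first.
  - rewrite -(ncard_image f_inj); last first.
      apply: sub_finite_set (finite_component setT u.+1) => w.
      by case=> _ [i [m [/sL[_ dm] ->]]]; split; rewrite // mdegD mdeg1 dm.
    congr ncard; apply/seteqP; split=> w.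
      move=> [_ [_ [i [m [Lm ->]]] <-]]; split=> //.
      by exists i, (f m); split; [exists m | exact: fCA].
    move=> [_ [i [_ [[m Lm <-] ->]]]].
    by exists (U_(i) + m)%MM; [split=> //; exists i, m | exact: fCA].
  - split=> [_ [m /sL[_ dm] <-]|_ v [m Lm <-] [_ dv] lt_mv].
      by split; rewrite // /f mdegD mdeg1 dm.
    have dm : mdeg (f m) = mdeg v by have [_ dm] := sL _ Lm; rewrite mdegD mdeg1 dm.
    have v0 : (0 < v ord0)%N.
      have [i eq_lt lt_i] := ltmcP dm lt_mv.
      have [/eqP i0|i_gt0] := posnP (val i).
        have Ei : i = ord0 by apply/val_inj/eqP.
        by move: lt_i; rewrite Ei; apply: leq_ltn_trans.
      by rewrite -(eq_lt ord0 i_gt0) mnmDE mnm1E eqxx.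
    have Ev : f (v - U_(ord0))%MM = v by rewrite /f addmC submK // lep1mP -lt0n.
    exists (v - U_(ord0))%MM => //; apply: upL Lm _ _.
      by split=> //; move: dv; rewrite -{1}Ev mdegD mdeg1 => -[].
    by move: lt_mv; rewrite -{1}Ev ltmc_add2r.
  - by rewrite ncard_image.
have up r u M : lex_growth (setT : set 'X_{1.. k.+1}) u d M ->
    lex_growth (setT : set 'X_{1.. k.+1}) (r + u) d M.
  by elim: r => //= r IHr /IHr /up1.
by move=> /(up s') G /(up s) G'; apply: lex_growth_uniq G _; rewrite addnC.
Qed.

(* Main.v *)
Require Import Defs.
From mathcomp Require Import zify.

(** A monomial w of R_1 . L factors uniquely as x_i m with i at least the index
    of every variable dividing m: x_i must be the last variable of w.  If L is a
    lexsegment set, this m lies in L, because replacing the variable that led to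
    w by the last one only moves m up in the order.  Hence |R_1 . L| is the sum
    over m in L of the growth of m, the number of indices i with x_i m nonzero
    and no variable after x_i in m ([lex_growth_mons]), and d_{n,t} is a partial
    sum of the word of growths of all the monomials of degree t, listed in
    decreasing order ([d_ntE]).

    In a polynomial ring this word satisfies a recursion: sorting by the
    exponent of x_1, the word of degree t in k+2 variables is the concatenation
    of the words of degrees 0, ..., t in k+1 variables, with 1 added to the first
    letter ([growths], [map_polygrowth]).  In the ring with x_1^a = 0 and k+2
    variables it is the same word when t + 1 < a, and otherwise the
    concatenation of the words of degrees t + 1 - a, ..., t in k+1 variables,
    the extra 1 being lost because x_1^a vanishes ([quot_growths]).  Since in
    k+1 >= 2 variables the word of each degree is a proper prefix of the next one,
    once t + 1 - a is large the first d letters no longer depend on t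
    and their sum is the Macaulay value of d; this is the last assertion.

    The two inequalities then compare partial sums of such concatenations (a
    single variable is checked directly).  The key fact is that the words of the
    polynomial ring are balanced: among their factors of a given length, the
    prefix has the largest sum and the suffix the smallest ([growths_balanced]).  It replaces the theorems of
    Macaulay and Clements-Lindstrom on the minimality of lexsegments, and is
    proved by induction on the number of variables.  Balance gives that starting
    the concatenation one degree later cannot increase a partial sum
    ([psum_blocks_shift]), which is the comparison of degrees t and t + 1;
    together with the recursion this gives the comparison of n and n + 1
    variables, as a word in one more variable is the concatenation from degree 0,
    which dominates all the others, with 1 added ([psum_blocksS]). *)

Set Implicit Arguments.
Unset Strict Implicit.
Unset Printing Implicit Defensive.

Import Order.TTheory.

Local Open Scope classical_set_scope.
Local Open Scope nat_scope.

(** * Words of growths *)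

Definition psum d s := sumn (take d s).

(** The word of growths, in decreasing lexicographic order, of the monomials of
    degree t in k+1 variables (see [map_polygrowth]).  Its leading letter is the
    growth of x_1^t, which every variable may extend. *)
Fixpoint growths k t : seq nat :=
  if k is k'.+1 then k.+1 :: flatten [seq growths k' i | i <- iota 1 t]
  else [:: 1].

Definition blocks k i r := flatten [seq growths k j | j <- iota i r].

Lemma psum0 s : psum 0 s = 0.
Proof. by rewrite /psum take0. Qed.

Lemma psum_cat d s s' : psum d (s ++ s') = psum d s + psum (d - size s) s'.
Proof.
rewrite /psum take_cat; case: ltnP => [lt_ds|le_sd].
  by rewrite (eqP (ltnW lt_ds : d - size s == 0)) take0 addn0.
by rewrite sumn_cat (take_oversize le_sd).
Qed.

Lemma psum_size d s : size s <= d -> psum d s = sumn s.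
Proof. by move=> le_sd; rewrite /psum take_oversize. Qed.

Lemma leq_psum d d' s : d <= d' -> psum d s <= psum d' s.
Proof.
elim: s d d' => [|x s IHs] [|d] [|d'] //= le_dd'; rewrite ?psum0 //.
by rewrite /psum /= leq_add2l IHs.
Qed.

Lemma psum_prefix d s s' : d <= size s -> prefix s s' -> psum d s = psum d s'.
Proof.
move=> le_ds /prefixP[s1 ->].
by rewrite psum_cat (eqP (le_ds : d - size s == 0)) psum0 addn0.
Qed.

Lemma blocks_cons k i r : blocks k i r.+1 = growths k i ++ blocks k i.+1 r.
Proof. by []. Qed.

Lemma blocks_cat k i r r' :
  blocks k i (r + r') = blocks k i r ++ blocks k (i + r) r'.
Proof. by rewrite /blocks iotaD map_cat flatten_cat. Qed.

Lemma blocks_rcons k i r : blocks k i r.+1 = blocks k i r ++ growths k (i + r).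
Proof. by rewrite -addn1 blocks_cat /blocks /= cats0. Qed.

Lemma growths0 k : growths k 0 = [:: k.+1].
Proof. by case: k. Qed.

(** The monomials of degree t+1 divisible by x_1, then those free of x_1. *)
Lemma growthsS k t : growths k.+1 t.+1 = growths k.+1 t ++ growths k t.+1.
Proof. by have := blocks_rcons k 1 t; rewrite /blocks /= => ->. Qed.

Lemma size_growthsS k t : size (growths k.+1 t) = size (blocks k 0 t.+1).
Proof. by rewrite blocks_cons growths0. Qed.

Lemma psum_growthsS d k t :
  psum d (growths k.+1 t) = (0 < d) + psum d (blocks k 0 t.+1).
Proof. by rewrite blocks_cons growths0; case: d. Qed.

Lemma growths_prefix k i j : i <= j -> prefix (growths k i) (growths k j).
Proof.
case: k => // k /subnKC <-; elim: (j - i) => [|r IHr]; first by rewrite addn0 prefix_refl.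
by rewrite addnS growthsS prefix_catl.
Qed.

(** With truncated subtraction this says two things at once.  If x + y <= size s,
    the factor of length y after the first x letters has at most the sum of the
    prefix of length y; if x + y >= size s, the factor of length size s - y
    ending at position x has at least the sum of the suffix of that length. *)
Definition balanced s := forall x y, x <= size s -> y <= size s ->
  psum (x + y) s + psum (x + y - size s) s <= psum x s + psum y s.

Lemma balanced_sub s x y :
  balanced s -> x <= size s -> y <= size s ->
  psum (x + y) s <= psum x s + psum y s.
Proof. by move=> bs xs ys; apply: leq_trans (bs x y xs ys); apply: leq_addr. Qed.

(** * Balance of the words of growths *)

Section Step.
Variable k : nat.
Hypothesis bal : forall t, balanced (growths k t).
(* H is the Hilbert function of the polynomial ring in k+1 variables, and F is
   the Macaulay function d |-> d^{<k>}, computed in degree t for d <= H t. *)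
Let F t x := psum x (growths k t).
Let H t := size (growths k t).

Lemma leqH i j : i <= j -> H i <= H j.
Proof. by move=> /(growths_prefix k)/size_prefix. Qed.

Lemma eqF i j x : i <= j -> x <= H i -> F i x = F j x.
Proof. by move=> le_ij le_x; apply: psum_prefix le_x (growths_prefix _ _). Qed.

Lemma leF_blocks i r x : x <= H i -> psum x (blocks k i r) <= F i x.
Proof.
case: r => // r; rewrite blocks_cons psum_cat => le_x.
by rewrite (eqP (le_x : x - size _ == 0)) psum0 addn0.
Qed.

Lemma F_blocks i r x : x <= H i -> psum x (blocks k i r.+1) = F i x.
Proof.
rewrite blocks_cons psum_cat => le_x.
by rewrite (eqP (le_x : x - size _ == 0)) psum0 addn0.
Qed.

Lemma psum_blocks_addn i r x : psum (H i + x) (blocks k i r.+1) =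
  F i (H i) + psum x (blocks k i.+1 r).
Proof.
rewrite blocks_cons psum_cat addKn; congr (_ + _).
by rewrite /F !psum_size ?leq_addr.
Qed.

(** The first c letters of a word are worth at least as much as any c letters
    that a longer partial sum would take instead.  While l exceeds the first
    word of the concatenation, c can be carried over to the next word, of which
    the c letters are still a prefix; in the last step everything happens inside
    one word and its balance applies. *)
Lemma psum_merge i r l c : c <= H i ->
  psum (l + c) (blocks k i r) <= psum l (blocks k i r) + F i c.
Proof.
elim: r i l => // r IHr i l le_c.
have [le_l|/ltnW/subnKC <-] := leqP l (H i); last first.
  rewrite -addnA !psum_blocks_addn -addnA leq_add2l (eqF (leqnSn i) le_c).
  by apply: IHr; apply: leq_trans le_c (leqH _).
rewrite (F_blocks _ le_l); have := @bal i l c le_l le_c; rewrite -/(H i).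
apply: leq_trans; rewrite blocks_cons psum_cat leq_add2l -/(H i).
have le_d : l + c - H i <= H i by lia.
rewrite -/(F i _) (eqF (leqnSn i) le_d).
by apply/leF_blocks/(leq_trans le_d)/leqH.
Qed.

(** The first word is also a prefix of the next one, so [psum_merge] applies to
    its letters. *)
Lemma psum_blocks_shift_rcons i r x : psum x (blocks k i.+1 r) <= psum x (blocks k i r.+1).
Proof.
have [le_x|/ltnW/subnKC Ex] := leqP x (H i).
  rewrite (F_blocks _ le_x) (eqF (leqnSn i) le_x).
  by apply/leF_blocks/(leq_trans le_x)/leqH.
rewrite -Ex psum_blocks_addn addnC [leqRHS]addnC (eqF (leqnSn i) (leqnn _)).
by apply/psum_merge/leqH.
Qed.

Lemma psum_blocksD_le i r x y :
  psum (x + y) (blocks k i r) <= psum x (blocks k i r) + psum y (blocks k i r).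
Proof.
elim: r i x => // r IHr i x.
have [le_x|/ltnW/subnKC <-] := leqP x (H i).
  by rewrite (addnC x) (addnC (psum x _)) (F_blocks _ le_x); apply: psum_merge.
rewrite -addnA !psum_blocks_addn -addnA leq_add2l.
by apply: leq_trans (IHr _ _) _; rewrite leq_add2l psum_blocks_shift_rcons.
Qed.

(** Each factor of length l of the concatenation dominates the suffix of length l
    of the word of any degree q not below the degrees used.  Such a factor is a
    suffix of one word, some full words, and a prefix of another one.  The
    prefixes dominate any factor of the same length, so they can be matched with
    all but the last letters of the suffix; the only piece that is not a prefix,
    the one at the start of the factor, is matched with these last letters, by
    balance. *)
Lemma psum_suffix q i r l x : i + r <= q.+1 -> l <= H q -> l <= x ->
  x <= size (blocks k i r) ->
  F q (H q) + psum (x - l) (blocks k i r) <= F q (H q - l) + psum x (blocks k i r).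
Proof.
elim: r l x => [|r IHr] l x le_iq le_l le_lx.
  rewrite leqn0 => /eqP x0; have l0 : l = 0 by lia.
  by rewrite l0 !subn0.
rewrite blocks_rcons size_cat !psum_cat => le_x.
set N := size (blocks k i r) in le_x *; set j := i + r in le_x *.
have le_jq : j <= q by lia.
have [le_xN|/ltnW le_Nx] := leqP x N.
  have -> : x - l - N = 0 by lia.
  by rewrite (eqP (le_xN : x - N == 0)) !psum0 !addn0; apply: IHr => //; lia.
have le_e : x - N <= H j by rewrite leq_subLR.
rewrite -!/(F j _) (eqF le_jq le_e) [psum x _]psum_size //.
(* Either the factor fits in the last word, or it is split at its start N. *)
have [le_le|lt_el] := leqP l (x - N).
  rewrite (@eqF j q) //; last by lia.
  rewrite psum_size; last by rewrite -/N; lia.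
  have := @bal q (H q - l) (x - N) (leq_subr _ _) (leq_trans le_e (leqH le_jq)).
  rewrite -/(H q) -!/(F q _).
  have -> : H q - l + (x - N) - H q = x - l - N by lia.
  have : F q (H q) <= F q (H q - l + (x - N)) by apply: leq_psum; lia.
  lia.
have -> : x - l - N = 0 by lia.
rewrite (psum0 _ : F j 0 = 0) addn0.
have le1 : i + r <= q.+1 by lia.
have le2 : l - (x - N) <= H q by lia.
have le3 : l - (x - N) <= N by lia.
have := IHr _ N le1 le2 le3 (leqnn _).
rewrite [psum N _]psum_size //.
have -> : N - (l - (x - N)) = x - l by lia.
have -> : H q - (l - (x - N)) = H q - l + (x - N) by lia.
have := balanced_sub (@bal q) (leq_subr l _) (leq_trans le_e (leqH le_jq)).
rewrite -/(H q) -!/(F q _); lia.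
Qed.

(** The second half of balance, when the suffix to compare with lies within the
    last word of the concatenation. *)
Lemma balancedS_last q x y :
  x <= size (growths k.+1 q.+1) ->
  size (growths k.+1 q) <= y <= size (growths k.+1 q.+1) ->
  size (growths k.+1 q.+1) <= x + y ->
  sumn (growths k.+1 q.+1) + psum (x + y - size (growths k.+1 q.+1)) (growths k.+1 q.+1)
    <= psum x (growths k.+1 q.+1) + psum y (growths k.+1 q.+1).
Proof.
set s := growths k.+1 q.+1 => le_x /andP[le_y1 le_y] le_xy.
have Es : s = growths k.+1 q ++ growths k q.+1 by rewrite /s growthsS.
have ss : size s = size (growths k.+1 q) + H q.+1 by rewrite Es size_cat.
set l := size s - y.
have le_l : l <= H q.+1 by rewrite /l; lia.
have -> : x + y - size s = x - l by rewrite /l; lia.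
have le_lx : l <= x by rewrite /l; lia.
have le_x' : x <= size (blocks k 0 q.+2) by rewrite -size_growthsS.
have := @psum_suffix q.+1 0 q.+2 l x (leqnn _) le_l le_lx le_x'.
have -> : psum y s = sumn (growths k.+1 q) + F q.+1 (H q.+1 - l).
  rewrite Es psum_cat psum_size //; congr (_ + F _ _); rewrite /l; lia.
have -> : sumn s = sumn (growths k.+1 q) + F q.+1 (H q.+1).
  by rewrite Es sumn_cat /F psum_size.
rewrite /s !psum_growthsS.
have : (0 < x - l) <= (0 < x) by case: (x) => //= ?; case: (_ - _).
lia.
Qed.

(** The first half of balance is subadditivity over the concatenation.  For the
    second half, when both x and y fall short of the last word, the word of the
    previous degree, a prefix of this one, lets one replace (x, y) by the pair
    (x + y - n, n) with n its length, and [balancedS_last] applies. *)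
Lemma balancedS t : balanced (growths k.+1 t).
Proof.
move=> x y; have [lt_xy _ _|] := ltnP (x + y) (size (growths k.+1 t)).
  rewrite (eqP (ltnW lt_xy : _ - _ == 0)) psum0 addn0 !psum_growthsS.
  have := psum_blocksD_le 0 t.+1 x y; have := addn_gt0 x y.
  by case: (0 < x); case: (0 < y) => /= ->; lia.
move=> le_xy le_x le_y; rewrite [psum (x + y) _]psum_size //.
elim: t x y le_xy le_x le_y => [|t IHt] x y le_xy le_x le_y.
  move: le_xy le_x le_y; rewrite !growths0 /psum /=.
  by case: x y => [|[|x]] [|[|y]] // _ _ _; rewrite /= ?addn0.
have [lt_x|le_x1] := ltnP x (size (growths k.+1 t)); last first.
  rewrite (addnC x) [leqRHS]addnC.
  by apply: balancedS_last; rewrite ?le_x1 // addnC.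
have [lt_y|le_y1] := ltnP y (size (growths k.+1 t)); last first.
  by apply: balancedS_last; rewrite ?le_y1.
set n := size (growths k.+1 t) in lt_x lt_y *.
have p := growths_prefix k.+1 (leqnSn t).
have le_n := size_prefix p; rewrite -/n in le_n.
have := IHt x y _ (ltnW lt_x) (ltnW lt_y); rewrite -/n.
rewrite -[sumn (growths k.+1 t)](psum_size (leqnn _)) -/n.
rewrite (psum_prefix (ltnW lt_x) p) (psum_prefix (ltnW lt_y) p) (psum_prefix (leqnn _) p) -/n.
rewrite (@psum_prefix (x + y - n) _ _ _ p) -/n; last by lia.
move=> IH; apply: leq_trans (IH _); last exact: leq_trans le_n le_xy.
have le_nxy := leq_trans le_n le_xy.
have := @balancedS_last t (x + y - n) n; rewrite -/n subnK // leqnn andTb.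
rewrite [psum n _ + _]addnC; apply=> //.
by apply: leq_trans le_x; rewrite leq_subLR addnC leq_add2r ltnW.
Qed.

End Step.

Lemma growths_balanced k t : balanced (growths k t).
Proof.
elim: k t => [|k IHk] t; last exact: balancedS.
by case=> [|[|x]] [|[|y]].
Qed.

(** * Comparing concatenations *)

Lemma psum_blocks_shift k i r d : d <= size (blocks k i r) ->
  psum d (blocks k i.+1 r) <= psum d (blocks k i r).
Proof.
move=> le_d; rewrite [leqRHS](@psum_prefix _ _ (blocks k i r.+1)) //.
  exact/psum_blocks_shift_rcons/growths_balanced.
by rewrite blocks_rcons prefix_prefix.
Qed.

Lemma psum_blocks_from0 k i r d : psum d (blocks k i r) <= psum d (blocks k 0 (i + r)).
Proof.
elim: i r => // i IHi r; apply: leq_trans (psum_blocks_shift_rcons (@growths_balanced k) _ _ _) _.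
by rewrite addSnnS.
Qed.

(** By [psum_growthsS], the first word on the right is the concatenation of the
    words of degrees 0, ..., i in one variable fewer, plus 1; with the rest
    compared by induction, the right side exceeds by 1 a partial sum of the
    concatenation starting in degree 0, and this start is the best one. *)
Lemma psum_blocksS k i r d :
  (0 < d) && (0 < r) + psum d (blocks k i r) <= psum d (blocks k.+1 i r).
Proof.
elim: r i d => [|r IHr] i d; first by rewrite andbF.
rewrite andbT; have := psum_blocks_from0 k i r.+1 d.
rewrite -addSnnS blocks_cat (blocks_cons k.+1) (psum_cat _ (blocks k 0 _))
  (psum_cat _ (growths k.+1 _)) psum_growthsS size_growthsS.
have := IHr i.+1 (d - size (blocks k 0 i.+1)); rewrite add0n; lia.
Qed.

(** * Enumeration of the monomials of a given degree *)

Lemma ncard_seq (T : choiceType) (s : seq T) : uniq s -> ncard [set` s] = size s.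
Proof.
move=> s_uniq; apply/perm_size/uniq_perm => // x.
rewrite in_fset_set; last exact: finite_seq.
by apply/idP/idP; rewrite in_setE.
Qed.

Definition mcons n k (m : 'X_{1.. n}) : 'X_{1.. n.+1} :=
  [multinom if unlift ord0 i is Some j then m j else k | i < n.+1].

Lemma mcons0 n k (m : 'X_{1.. n}) : mcons k m ord0 = k.
Proof. by rewrite mnmE unlift_none. Qed.

Lemma mconsS n k (m : 'X_{1.. n}) j : mcons k m (lift ord0 j) = m j.
Proof. by rewrite mnmE liftK. Qed.

Lemma mdeg_mcons n k (m : 'X_{1.. n}) : mdeg (mcons k m) = k + mdeg m.
Proof.
rewrite !mdegE big_ord_recl mcons0; congr (_ + _).
by apply: eq_bigr => i _; rewrite mconsS.
Qed.

Lemma mconsP n (m : 'X_{1.. n.+1}) : exists k m', m = mcons k m'.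
Proof.
exists (m ord0), [multinom m (lift ord0 i) | i < n].
by apply/mnmP => i; case: (unliftP ord0 i) => [j|] ->; rewrite ?mconsS ?mcons0 ?mnmE.
Qed.

Lemma ltm_mcons n k k' (m m' : 'X_{1.. n}) :
  mdeg (mcons k m) = mdeg (mcons k' m') ->
  (mcons k m < mcons k' m')%O = (k < k') || (k == k') && (m < m')%O.
Proof.
move=> eq_deg; have := eq_deg; rewrite !mdeg_mcons => eq_kdeg.
apply/(ltmcP eq_deg)/orP => [[i]|[lt_k|/andP[/eqP Ek]]].
- case: (unliftP ord0 i) => [j|] ->; rewrite ?mcons0 ?mconsS; last by left.
  move=> eq_j lt_j; have /= := eq_j ord0 isT; rewrite !mcons0 => Ek; right.
  rewrite Ek eqxx; apply/ltmcP; first by move: eq_kdeg; rewrite Ek => /addnI.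
  exists j => // j' lt_j'; have := eq_j (lift ord0 j'); rewrite !mconsS; apply.
  by rewrite !lift0 ltnS.
- by exists ord0; rewrite ?mcons0.
have eq_d : mdeg m = mdeg m' by move: eq_kdeg; rewrite Ek => /addnI.
case/(ltmcP eq_d) => i eq_i lt_i; exists (lift ord0 i); rewrite ?mconsS // => j.
case: (unliftP ord0 j) => [j'|] ->; rewrite ?mcons0 ?mconsS // !lift0 ltnS.
exact: eq_i.
Qed.

Lemma mcons_eq0 n k (m : 'X_{1.. n}) : (mcons k m == 0%MM) = (k == 0) && (m == 0%MM).
Proof. by rewrite -!mdeg_eq0 mdeg_mcons addn_eq0. Qed.

(** The degree i of the part free of the first variable increases, so that the
    monomials come in decreasing order ([pairwise_monomials]). *)
Fixpoint monomials n t : seq 'X_{1.. n} :=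
  if n is n'.+1 then [seq mcons (t - i) m | i <- iota 0 t.+1, m <- monomials n' i]
  else if t is 0 then [:: 0%MM] else [::].

Lemma monomialsS n t : monomials n.+1 t =
  [seq mcons (t - i) m | i <- iota 0 t.+1, m <- monomials n i].
Proof. by []. Qed.

Lemma mem_monomials n t m : (m \in monomials n t) = (mdeg m == t).
Proof.
elim: n t m => [|n IHn] t m.
  have -> : m = 0%MM by apply/mnmP => -[].
  by rewrite mdeg0; case: t => [|t] //=; rewrite inE eqxx.
rewrite monomialsS.
apply/allpairsPdep/eqP => [[i [m' []]]|].
  rewrite mem_iota IHn /= => le_it /eqP dm' ->.
  by rewrite mdeg_mcons dm' subnK.
have [k [m' ->]] := mconsP m; rewrite mdeg_mcons => <-.
by exists (mdeg m'), m'; rewrite mem_iota IHn addnK eqxx /= ltnS leq_addl.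
Qed.

Lemma pairwise_monomials n t : pairwise >%O (monomials n t).
Proof.
elim: n t => [|n IHn] t; first by case: t.
rewrite monomialsS; move: {-2}(t.+1) 0 (add0n t.+1).
move=> r i /eqP; rewrite eqn_leq => /andP[+ _].
elim: r i => // r IHr i le_irt /=.
rewrite pairwise_cat IHr; last by rewrite addSnnS.
rewrite andbT; apply/andP; split.
  apply/allrelP => _ _ /mapP[m + ->] /allpairsPdep[j [m' [+ + ->]]].
  rewrite mem_iota !mem_monomials => /eqP dm /andP[lt_ij lt_j] /eqP dm'.
  rewrite /= ltm_mcons; last by rewrite !mdeg_mcons dm dm' !subnK //; lia.
  by apply/orP; left; lia.
rewrite pairwise_map; apply: (sub_in_pairwise (P := mem_seq (monomials n i))) (IHn i) => //.
move=> m m' /[!mem_monomials] => /eqP dm /eqP dm' lt_m.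
rewrite /= ltm_mcons; last by rewrite !mdeg_mcons dm dm'.
by rewrite eqxx (lt_m : (m' < m)%O) orbT.
Qed.

Lemma monomials0 n : monomials n 0 = [:: 0%MM].
Proof.
elim: n => // n IHn; rewrite /= IHn /=; congr [:: _].
by apply/eqP; rewrite mcons_eq0 !eqxx.
Qed.

(** * Growth of a lexsegment set *)

Definition last_le n (m : 'X_{1.. n}) (i : 'I_n) :=
  [forall j : 'I_n, (i < j) ==> (m j == 0)].

Section LexGrowth.
Variables (n : nat) (B : set 'X_{1.. n}) (b : pred 'X_{1.. n}).
Hypothesis bP : forall m, reflect (B m) (b m).
Hypothesis b_closed : forall i m, b (U_(i) + m)%MM -> b m.

Let mons t := [seq m <- monomials n t | b m].

Definition mon_growth m := \sum_(i < n) (last_le m i && b (U_(i) + m)%MM : nat).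

Let mons_component t : [set` mons t] = component B t.
Proof.
apply/seteqP; split=> m /=; rewrite mem_filter mem_monomials.
  by case/andP=> /bP ? /eqP.
by case=> /bP-> ->; rewrite eqxx.
Qed.

Let mons_uniq t : uniq (mons t).
Proof.
apply/filter_uniq/(pairwise_uniq (r := >%O)); last exact: pairwise_monomials.
by move=> m; apply: ltxx.
Qed.

Lemma ncard_component t : ncard (component B t) = size (mons t).
Proof. by rewrite -mons_component ncard_seq. Qed.

Lemma lexsegment_take t d : lexsegment B t [set` take d (mons t)].
Proof.
split=> [m /= /mem_take|m v /= m_in Cv lt_mv].
  by rewrite -mons_component.
have : v \in mons t by move: Cv; rewrite -mons_component.
rewrite -{1}(cat_take_drop d (mons t)) mem_cat => /orP[//|v_in].
have : pairwise >%O (mons t) by rewrite pairwise_filter // pairwise_monomials.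
rewrite -{1}(cat_take_drop d (mons t)) pairwise_cat => /and3P[/allrelP/(_ m v m_in v_in) + _ _].
by move=> /= lt_vm; move: (lt_trans lt_mv lt_vm); rewrite ltxx.
Qed.

(* x_i is the last variable of x_i m, which determines i and then m. *)
Let last_le_inj (m m' : 'X_{1.. n}) (i i' : 'I_n) : last_le m i -> last_le m' i' ->
  (U_(i) + m)%MM = (U_(i') + m')%MM -> i = i' /\ m = m'.
Proof.
move=> /forallP li /forallP li' E.
have Ei : i = i'.
  case: (ltngtP i i') => [lt_i|lt_i|/val_inj//].
    move: (li i'); rewrite lt_i /= => /eqP mi'; have /mnmP/(_ i') := E.
    by rewrite !mnmDE !mnm1E eqxx mi'; case: eqP lt_i => // ->; rewrite ltnn.
  move: (li' i); rewrite lt_i /= => /eqP m'i; have /mnmP/(_ i) := E.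
  by rewrite !mnmDE !mnm1E eqxx m'i; case: eqP lt_i => // ->; rewrite ltnn.
by split=> //; apply/eqP; move/eqP: E; rewrite Ei eqm_add2l.
Qed.

Let grown s : seq 'X_{1.. n} :=
  [seq (U_(i) + m)%MM | m <- s, i <- [seq i <- enum 'I_n | last_le m i && b (U_(i) + m)%MM]].

Let size_grown s : size (grown s) = sumn (map mon_growth s).
Proof.
rewrite size_allpairs_dep; congr sumn; apply: eq_map => m.
rewrite size_filter -sum1_count /mon_growth -big_enum big_mkcond /=.
by apply: eq_bigr => i _; case: (_ && _).
Qed.

Let uniq_grown s : uniq s -> uniq (grown s).
Proof.
move=> s_uniq; apply: allpairs_uniq_dep => // [m _|].
  exact/filter_uniq/enum_uniq.
move=> _ _ /allpairsPdep[m [i [_ + ->]]] /allpairsPdep[m' [i' [_ + ->]]] /=.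
rewrite !mem_filter => /andP[/andP[li _] _] /andP[/andP[li' _] _].
by move=> /(last_le_inj li li')[-> ->].
Qed.

(* If w = x_i m with m in the lexsegment set and x_j is the last variable of w,
   then i <= j and w / x_j is m or larger than m, hence in the set. *)
Let mul_vars_grown t s : lexsegment B t [set` s] -> mul_vars B [set` s] = [set` grown s].
Proof.
move=> [sC up]; apply/seteqP; split=> w /=; last first.
  move=> /allpairsPdep[m [i [m_in + ->]]]; rewrite mem_filter => /andP[/andP[_ /bP Bw] _].
  by split=> //; exists i, m.
move=> [/bP bw [i [m [m_in Ew]]]].
have wi : 0 < w i by rewrite Ew mnmDE mnm1E eqxx.
case: (@arg_maxnP _ i (fun j => 0 < w j) val wi) => j wj maxj.
have Ew' : w = (U_(j) + (w - U_(j)))%MM by rewrite addmC submK // lep1mP -lt0n.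
set m' := (w - U_(j))%MM in Ew'.
have lj : last_le m' j.
  apply/forallP => j'; apply/implyP => lt_j; rewrite mnmBE.
  case: (posnP (w j')) => [->|/maxj /=]; first by rewrite sub0n.
  by rewrite leqNgt lt_j.
apply/allpairsPdep; exists m', j; split=> //; last first.
  by rewrite mem_filter lj -Ew' bw mem_enum.
have dm : mdeg m = t by have [] := sC _ m_in.
have dm' : mdeg m' = t.
  have := congr1 mdeg Ew; rewrite {1}Ew' !mdegD !mdeg1 dm.
  exact: addnI.
have /= := maxj i wi; rewrite leq_eqVlt => /predU1P[/val_inj Eij|lt_ij].
  suff -> : m' = m by [].
  by apply/eqP; rewrite -(eqm_add2l U_(j)) -Ew' Ew Eij.
apply: (up m) => //; first by split=> //; apply/bP/(b_closed (i := j)); rewrite -Ew'.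
apply/ltmcP; first by rewrite dm.
have m'E (k : 'I_n) : (i == k) + m k = (j == k) + m' k.
  by have /mnmP/(_ k) := Ew; rewrite {1}Ew' !mnmDE !mnm1E => <-.
have gt_neq (x y : 'I_n) : x < y -> (y == x) = false.
  by move=> lt_xy; apply/eqP => E; move: lt_xy; rewrite E ltnn.
exists i => [k lt_k|]; last by have := m'E i; rewrite eqxx gt_neq // add1n add0n => <-.
by have := m'E k; rewrite !gt_neq //; apply: ltn_trans lt_k lt_ij.
Qed.

Lemma lex_growth_mons t d : d <= size (mons t) ->
  lex_growth B t d (psum d (map mon_growth (mons t))).
Proof.
move=> le_d; exists [set` take d (mons t)]; split.
- exact: lexsegment_take.
- by rewrite ncard_seq ?take_uniq // size_takel.
rewrite (mul_vars_grown (lexsegment_take t d)) ncard_seq ?uniq_grown ?take_uniq //.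
by rewrite size_grown map_take.
Qed.

End LexGrowth.

(** * The growths form the words *)

Lemma last_le_mcons0 n k (m : 'X_{1.. n}) : last_le (mcons k m) ord0 = (m == 0%MM).
Proof.
apply/forallP/eqP => [m0|-> i].
  by apply/mnmP => j; move: (m0 (lift ord0 j)); rewrite mconsS mnm0E lift0 => /eqP.
by case: (unliftP ord0 i) => [j|] ->; rewrite ?mconsS ?mnm0E ?eqxx ?implybT.
Qed.

Lemma last_le_mconsS n k (m : 'X_{1.. n}) j :
  last_le (mcons k m) (lift ord0 j) = last_le m j.
Proof.
apply/forallP/forallP => lj i; first by move: (lj (lift ord0 i)); rewrite mconsS !lift0.
by case: (unliftP ord0 i) => [i'|] ->; rewrite ?mconsS !lift0 ?ltnS //; apply: lj.
Qed.

Definition polygrowth n (m : 'X_{1.. n}) := \sum_(i < n) (last_le m i : nat).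

Lemma polygrowth_mcons n k (m : 'X_{1.. n}) :
  polygrowth (mcons k m) = (m == 0%MM) + polygrowth m.
Proof.
rewrite /polygrowth big_ord_recl last_le_mcons0; congr (_ + _).
by apply: eq_bigr => i _; rewrite last_le_mconsS.
Qed.

Lemma polygrowth0 n : polygrowth (0%MM : 'X_{1.. n}) = n.
Proof.
rewrite /polygrowth (eq_bigr (fun=> 1)) ?sum1_card ?card_ord // => i _.
suff -> : last_le 0%MM i by [].
by apply/forallP => j; rewrite mnm0E eqxx implybT.
Qed.

(** The growth of x_1^(t - j) m is that of m, x_1 not counted, unless m = 1: the
    second condition only excludes pure powers of x_1 to which x_1 may be added. *)
Lemma map_blocks n t i r (f : 'X_{1.. n.+2} -> nat) :
  (forall j, [seq polygrowth m | m <- monomials n.+1 j] = growths n j) ->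
  (forall j m, i <= j < i + r -> mdeg m = j -> f (mcons (t - j) m) = polygrowth m) ->
  [seq f m | m <- [seq mcons (t - j) m | j <- iota i r, m <- monomials n.+1 j]]
    = blocks n i r.
Proof.
move=> IHn Ef; rewrite map_flatten /blocks -map_comp; congr flatten.
apply/eq_in_map => j; rewrite mem_iota => j_in.
rewrite -IHn /= -map_comp; apply/eq_in_map => m.
by rewrite mem_monomials => /eqP dm; apply: Ef.
Qed.

Lemma monomials1 t : monomials 1 t = [:: mcons t 0%MM].
Proof.
have no_var r i : [seq mcons (t - j) m | j <- iota i.+1 r, m <- monomials 0 j] = [::].
  by elim: r i => // r IHr i; apply: IHr.
by rewrite monomialsS /= subn0 no_var.
Qed.

Lemma map_polygrowth n t :
  [seq polygrowth m | m <- monomials n.+1 t] = growths n t.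
Proof.
elim: n t => [|n IHn] t.
  by rewrite monomials1 /= polygrowth_mcons eqxx polygrowth0.
rewrite monomialsS -[iota 0 t.+1]/(0 :: iota 1 t) allpairs_cons monomials0 map_cat.
rewrite map_blocks // => [|j m /andP[j_gt0 _] dm].
  by rewrite /= polygrowth_mcons eqxx polygrowth0.
rewrite polygrowth_mcons; case: eqP => // m0; move: j_gt0.
by rewrite -dm m0 mdeg0.
Qed.

(** The word of growths in degree t of the ring in n+1 variables with x_1^a = 0.
    The exponents of x_1 are at most a - 1, so the other variables have degree at
    least t + 1 - a; the growth of x_1^(a-1) does not count x_1. *)
Definition quot_growths a n t :=
  if t.+1 < a then growths n t
  else if n is n'.+1 then blocks n' (t.+1 - a) a else nseq (t.+1 == a) 0.

Definition x1_lt a n : pred 'X_{1.. n.+1} := fun m => m ord0 < a.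
Arguments x1_lt : clear implicits.

Lemma leq_mdeg n (m : 'X_{1.. n}) i : m i <= mdeg m.
Proof. by rewrite mdegE (bigD1 i) //= leq_addr. Qed.

Lemma mon_growth_x1_lt n a k (m : 'X_{1.. n}) : k < a ->
  mon_growth (x1_lt a n) (mcons k m) = (m == 0%MM) && (k.+1 < a) + polygrowth m.
Proof.
move=> lt_ka; rewrite /mon_growth big_ord_recl last_le_mcons0; congr (_ && _ + _).
  by rewrite /x1_lt mnmDE mnm1E eqxx mcons0.
apply: eq_bigr => i _; rewrite last_le_mconsS /x1_lt mnmDE mnm1E mcons0.
by rewrite lt_ka andbT.
Qed.

Lemma map_mon_growth_x1_lt a n t :
  [seq mon_growth (x1_lt a n) m | m <- monomials n.+1 t & x1_lt a n m]
    = quot_growths a n t.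
Proof.
rewrite /quot_growths; case: ltnP => [lt_ta|le_at].
  have lt_a m : m \in monomials n.+1 t -> forall i, (U_(i) + m)%MM ord0 < a.
    rewrite mem_monomials => /eqP dm i; apply: leq_ltn_trans lt_ta.
    by have := leq_mdeg (U_(i) + m)%MM ord0; rewrite mdegD mdeg1 dm.
  rewrite (all_filterP _); last first.
    apply/allP => m /lt_a/(_ ord0); apply: leq_ltn_trans.
    by rewrite mnmDE leq_addl.
  rewrite -map_polygrowth; apply/eq_in_map => m /lt_a lt_m.
  by apply: eq_bigr => i _; rewrite /x1_lt lt_m andbT.
case: n => [|n].
  rewrite monomials1 /= /x1_lt mcons0; case: ltnP => [lt_ta|].
    have Ea : t.+1 = a by apply/eqP; rewrite eqn_leq lt_ta.
    by rewrite -Ea eqxx /= mon_growth_x1_lt ?Ea // -Ea ltnn andbF /polygrowth big_ord0.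
  by case: eqP => // <-; rewrite ltnn.
have Et : t.+1 = (t.+1 - a) + a by rewrite subnK.
rewrite monomialsS {1}Et iotaD allpairs_cat filter_cat add0n.
rewrite (eq_in_filter (a2 := pred0)) ?filter_pred0 /=; last first.
  move=> _ /allpairsPdep[j [m [+ _ ->]]]; rewrite mem_iota /x1_lt mcons0; lia.
rewrite (all_filterP _); last first.
  by apply/allP => _ /allpairsPdep[j [m [+ _ ->]]]; rewrite mem_iota /x1_lt mcons0; lia.
apply: map_blocks => [j|j m j_in dm]; first exact: map_polygrowth.
rewrite mon_growth_x1_lt; last by lia.
case: eqP => // m0; move: dm; rewrite m0 mdeg0 => j0.
by have /negPf-> : ~~ ((t - j).+1 < a) by lia.
Qed.

Lemma nonzero_monE (F : fieldType) a n (m : 'X_{1.. n.+1}) :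
  reflect (nonzero_mon F a n.+1 m) (x1_lt a n m).
Proof.
apply/(iffP idP) => [lt_m|]; last by move/nonzero_monP => /(_ ord0 erefl).
by apply/nonzero_monP => i i0; rewrite (_ : i = ord0) //; apply/val_inj.
Qed.

Lemma x1_lt_closed a n i (m : 'X_{1.. n.+1}) :
  x1_lt a n (U_(i) + m)%MM -> x1_lt a n m.
Proof. by apply: leq_ltn_trans; rewrite mnmDE leq_addl. Qed.

Lemma ncard_quot_growths (F : fieldType) a n t :
  ncard (component (nonzero_mon F a n.+1) t) = size (quot_growths a n t).
Proof.
rewrite -map_mon_growth_x1_lt size_map.
exact/ncard_component/nonzero_monE.
Qed.

Lemma d_ntE (F : fieldType) a d n t : d <= size (quot_growths a n t) ->
  d_nt F a d n.+1 t = psum d (quot_growths a n t).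
Proof.
rewrite -map_mon_growth_x1_lt size_map => le_d.
have lexG := lex_growth_mons (@nonzero_monE F a n) (@x1_lt_closed a n) le_d.
by apply: (lex_growth_uniq _ lexG); apply: xgetPex; eexists; apply: lexG.
Qed.

Lemma macaulayE d k s : d <= size (growths k s) ->
  macaulay d k = psum d (growths k s).
Proof.
move=> le_d; pose b : pred 'X_{1.. k.+1} := xpredT.
have bP m : reflect (setT m) (b m) by apply/(iffP idP).
have Em : [seq mon_growth b m | m <- monomials k.+1 s & b m] = growths k s.
  rewrite filter_predT -map_polygrowth; apply: eq_map => m.
  by apply: eq_bigr => i _; rewrite andbT.
have lexG : lex_growth (setT : set 'X_{1.. k.+1}) s d (psum d (growths k s)).
  by rewrite -Em; apply: (lex_growth_mons bP) => //; rewrite -(size_map (mon_growth b)) Em.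
have [s' lexG'] : exists s', lex_growth (setT : set 'X_{1.. k.+1}) s' d (macaulay d k).
  apply: (@xgetPex _ 0 [set N | exists s, lex_growth (setT : set 'X_{1.. k.+1}) s d N]).
  by exists (psum d (growths k s)), s.
exact: lex_growth_deg lexG' lexG.
Qed.

Lemma size_growths k t : t < size (growths k.+1 t).
Proof.
elim: t => // t IHt; rewrite growthsS size_cat -addn1 leq_add //.
by case: k {IHt}.
Qed.

(** * Comparison in the quotient ring *)

Lemma psum_quot_growths_ltS a n t d :
  d <= size (quot_growths a n t) -> d <= size (quot_growths a n.+1 t) ->
  0 < d -> 0 < a -> psum d (quot_growths a n t) < psum d (quot_growths a n.+1 t).
Proof.
rewrite /quot_growths => + + d_gt0 a_gt0; case: ifP => _.
  move=> _ _; case: n => [|n].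
    by rewrite psum_growthsS d_gt0; case: d d_gt0.
  by rewrite !psum_growthsS d_gt0 !add1n ltnS; have := psum_blocksS n 0 t.+1 d; rewrite d_gt0.
case: n => [|n] le_d _; last by have := psum_blocksS n (t.+1 - a) a d; rewrite d_gt0 a_gt0.
move: le_d; rewrite size_nseq; case: eqP => //= [Et _|_]; last by rewrite leqNgt d_gt0.
by case: a a_gt0 Et => // a _ _; case: d d_gt0.
Qed.

Lemma psum_quot_growths_degS a n t d :
  d <= size (quot_growths a n t) -> d <= size (quot_growths a n t.+1) ->
  0 < d -> 0 < a -> psum d (quot_growths a n t.+1) <= psum d (quot_growths a n t).
Proof.
rewrite /quot_growths => + + d_gt0 a_gt0.
case: (ltnP t.+2 a) => [lt_ta|le_at].
  rewrite (ltnW lt_ta) => le_d _.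
  by rewrite (psum_prefix le_d (growths_prefix _ (leqnSn t))).
case: n => [|n].
  rewrite size_nseq => _; case: eqP => [Ea|_]; last by rewrite leqNgt d_gt0.
  by case: d d_gt0 => //= d _ _; rewrite /psum /=; case: (d).
case: ltnP => [lt_ta|le_at'] le_d _.
  (* Here t + 2 = a: passing to degree t + 1 only loses 1 on the first letter. *)
  have <- : t.+2 = a by apply/eqP; rewrite eqn_leq le_at andbT.
  rewrite subnn; move: le_d; rewrite size_growthsS psum_growthsS (blocks_rcons _ _ t.+1) psum_cat.
  by rewrite -subn_eq0 => /eqP->; rewrite psum0 addn0 leq_addl.
by rewrite subSn //; apply: psum_blocks_shift.
Qed.

Theorem proposition7 (F : fieldType) (a d n t : nat) :
  (0 < a)%N -> (0 < d)%N -> (0 < n)%N -> (0 < t)%N ->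
  [/\ (d <= ncard (component (nonzero_mon F a n) t))%N ->
      (d <= ncard (component (nonzero_mon F a n.+1) t))%N ->
      (d_nt F a d n t < d_nt F a d n.+1 t)%N,
      (d <= ncard (component (nonzero_mon F a n) t))%N ->
      (d <= ncard (component (nonzero_mon F a n) t.+1))%N ->
      (d_nt F a d n t.+1 <= d_nt F a d n t)%N
    & (3 <= n)%N ->
      exists T : nat, forall t' : nat, (T <= t')%N ->
        (d <= ncard (component (nonzero_mon F a n) t'))%N /\
        d_nt F a d n t' = macaulay d (n - 2)].
Proof.
case: n => // n a_gt0 d_gt0 _ _; split; rewrite ?ncard_quot_growths.
- by move=> le_d le_d'; rewrite !d_ntE //; apply: psum_quot_growths_ltS.
- by move=> le_d le_d'; rewrite !d_ntE //; apply: psum_quot_growths_degS.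
case: n => [|[|n]] // _; exists (a + d) => t' le_t'.
(* From degree a + d on, the first word has more than d letters. *)
have lt_d : d <= size (growths n.+1 (t'.+1 - a)).
  by apply: leq_trans (size_growths _ _); lia.
have Ex : quot_growths a n.+2 t' = blocks n.+1 (t'.+1 - a) a.
  by rewrite /quot_growths; case: ltnP => //; lia.
have le_d : d <= size (quot_growths a n.+2 t').
  rewrite Ex; case: (a) a_gt0 lt_d => // a' _ lt_d.
  by rewrite blocks_cons size_cat (leq_trans lt_d) ?leq_addr.
rewrite ncard_quot_growths; split=> //.
rewrite d_ntE // !subSS subn0 (macaulayE lt_d) Ex.
apply/esym/psum_prefix => //.
by case: (a) a_gt0 => // a' _; apply: prefix_prefix.
Qed.
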